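(* Two complete graphs are isomorphic if and only if they have the same path sequence.
   Context: Graphs are finite and simple. A path of length $h$ in $G$ is a subgraph that is a path with $h$ edges ($h+1$ distinct vertices); paths are undirected, and paths of length $0$ are single vertices. $P_h(G)$ is the number of paths of length $h$ in $G$. The path sequence of $G$ is $P(G)=(P_0(G),P_1(G),\ldots,P_\rho(G))$, where $\rho=\rho(G)$ is the length of a longest path in $G$. *)

(* Defs.v *)
From mathcomp Require Import all_boot.

Set Implicit Arguments.
Unset Strict Implicit.
Unset Printing Implicit Defensive.

Record sgraph := SGraph {
  vertex :> finType;
  edge : rel vertex;
  edge_sym : symmetric edge;
  edge_irrefl : irreflexive edge
}.

Definition complete (G : sgraph) : Prop :=
  forall x y : G, x != y -> edge x y.

Definition isomorphic (G H : sgraph) : Prop :=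
  exists2 f : G -> H, bijective f & forall x y : G, edge (f x) (f y) = edge x y.

(* A subgraph is encoded as a pair (vertex set, edge set), an edge being an
   unordered pair of vertices. In [path_subgraph s], [zip s (behead s)] lists
   the pairs of consecutive vertices of [s]. *)
Definition path_subgraph (G : sgraph) (s : seq G) : {set G} * {set {set G}} :=
  ([set x in s], [set [set e.1; e.2] | e in zip s (behead s)]).

(* Paths are subgraphs, not vertex sequences: a sequence and its reversal give
   the same element of this set. *)
Definition paths (G : sgraph) (h : nat) : {set {set G} * {set {set G}}} :=
  [set path_subgraph t | t : h.+1.-tuple G & uniq t && sorted (@edge G) t].

Definition path_count (G : sgraph) (h : nat) : nat := #|paths G h|.

(* A path of length h has h + 1 distinct vertices, so h < #|G|. *)
Definition longest_path_length (G : sgraph) : nat :=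
  \max_(h < #|G| | paths G h != set0) h.

(* The graph without vertices has no path; its sequence is [:: 0] here. *)
Definition path_sequence (G : sgraph) : seq nat :=
  mkseq (path_count G) (longest_path_length G).+1.

(* Main.v *)
Require Import Defs.
From mathcomp Require Import all_boot.

(** The number of vertices is the first entry of the path sequence, and a
    complete graph is determined up to isomorphism by its number of vertices. *)

(** Conversely, the path sequence is an isomorphism invariant of all graphs: an isomorphism carries
    paths injectively to paths of the same length, and so does its inverse, so all path counts agree
    ([isomorphic_path_count]). For the other direction, [path_count0] recovers the order of the
    graph and [complete_card_isomorphic] concludes. *)

Lemma isomorphic_sym (G H : sgraph) : isomorphic G H -> isomorphic H G.
Proof.
case=> f [g fK gK] f_edge; exists g; first by exists f.
by move=> x y; rewrite -f_edge !gK.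
Qed.

Lemma isomorphic_card (G H : sgraph) : isomorphic G H -> #|G| = #|H|.
Proof. by case=> f f_bij _; apply: bij_eq_card f_bij. Qed.

Definition subgraph_image (G H : sgraph) (f : G -> H)
    (p : {set G} * {set {set G}}) : {set H} * {set {set H}} :=
  (f @: p.1, [set f @: (e : {set G}) | e in p.2]).

(** Paths are counted as subgraphs, not as tuples, so injectivity is needed at this level. Taking
    direct images preserves injectivity: once for vertex sets, twice for edge sets. *)
Lemma subgraph_image_inj (G H : sgraph) (f : G -> H) :
  injective f -> injective (subgraph_image G H f).
Proof.
move=> f_inj [A E] [B F] [/(imset_inj f_inj) -> EF].
by rewrite (imset_inj (imset_inj f_inj) EF).
Qed.

Lemma zip_map2 (S S' T T' : Type) (f : S -> S') (g : T -> T') s t :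
  zip (map f s) (map g t) = [seq (f e.1, g e.2) | e <- zip s t].
Proof. by elim: s t => [|x s IHs] [|y t] //=; rewrite IHs. Qed.

Lemma subgraph_image_path (G H : sgraph) (f : G -> H) (s : seq G) :
  subgraph_image G H f (path_subgraph s) = path_subgraph (map f s).
Proof.
rewrite /subgraph_image /path_subgraph /=; congr pair.
  apply/setP=> y; rewrite inE; apply/imsetP/mapP=> [[x]|[x xs ->]].
    by rewrite inE => xs ->; exists x.
  by exists x; rewrite ?inE.
rewrite behead_map zip_map2 -imset_comp.
apply/setP=> A; apply/imsetP/imsetP=> [[e es ->]|[e /mapP[d ds ->] ->]].
  exists (f e.1, f e.2); last by rewrite /= imsetU !imset_set1.
  by apply/mapP; exists e.
by exists d; rewrite //= imsetU !imset_set1.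
Qed.

Lemma isomorphic_path_count_leq (G H : sgraph) (h : nat) :
  isomorphic G H -> path_count G h <= path_count H h.
Proof.
case=> f /bij_inj f_inj f_edge.
rewrite /path_count -(card_imset _ (subgraph_image_inj G H f f_inj)).
apply/subset_leq_card/subsetP=> _ /imsetP[_ /imsetP[t + ->] ->].
rewrite inE => /andP[t_uniq t_path]; rewrite subgraph_image_path.
apply/imsetP; exists (map_tuple f t) => //.
rewrite inE /= map_inj_uniq // t_uniq sorted_map /=.
by rewrite (eq_sorted (e' := @edge G)).
Qed.

Lemma isomorphic_path_count (G H : sgraph) (h : nat) :
  isomorphic G H -> path_count G h = path_count H h.
Proof.
move=> GH; apply/eqP; rewrite eqn_leq !isomorphic_path_count_leq //.
exact: isomorphic_sym.
Qed.

Lemma isomorphic_path_sequence (G H : sgraph) :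
  isomorphic G H -> path_sequence G = path_sequence H.
Proof.
move=> GH; have eq_count h := isomorphic_path_count G H h GH.
rewrite /path_sequence (eq_mkseq eq_count); congr (mkseq _ _.+1).
rewrite /longest_path_length (isomorphic_card _ _ GH).
(* A set of paths is nonempty iff its count is positive, so both maxima range over the same
   lengths. *)
by apply: eq_bigl => h; rewrite -!card_gt0 [#|_|]eq_count.
Qed.

Lemma path_count0 (G : sgraph) : path_count G 0 = #|G|.
Proof.
have vertex_inj : injective (fun x : G => path_subgraph [:: x]).
  (* The vertex set [[set x]] already determines [x]. *)
  move=> x y [/setP/(_ x)]; rewrite !inE eqxx => /esym/eqP //.
rewrite -(card_imset _ vertex_inj) /path_count; congr #|pred_of_set _|.
apply/setP=> p; apply/imsetP/imsetP=> [[t _ ->]|[x _ ->]].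
  by case/tupleP: t => x t; rewrite (tuple0 t); exists x.
by exists [tuple x]; rewrite ?inE.
Qed.

Lemma complete_edge (G : sgraph) (x y : G) :
  complete G -> edge x y = (x != y).
Proof. by move=> hG; case: eqVneq => [->|/hG]; rewrite ?edge_irrefl. Qed.

(** Adjacency in a complete graph is mere distinctness, so any bijection is an isomorphism; this one
    matches vertices of equal rank in the enumerations. *)
Lemma complete_card_isomorphic (G H : sgraph) :
  complete G -> complete H -> #|G| = #|H| -> isomorphic G H.
Proof.
move=> hG hH GH.
exists (fun x => enum_val (cast_ord GH (enum_rank x))).
  exists (fun y => enum_val (cast_ord (esym GH) (enum_rank y))) => x.
    by rewrite enum_valK cast_ordK enum_rankK.
  by rewrite enum_valK cast_ordKV enum_rankK.
move=> x y; rewrite !complete_edge //.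
by rewrite (inj_eq enum_val_inj) (inj_eq (@cast_ord_inj _ _ _)) (inj_eq enum_rank_inj).
Qed.

Theorem corollary2 (G H : sgraph) (hG : complete G) (hH : complete H) :
  isomorphic G H <-> path_sequence G = path_sequence H.
Proof.
(* Both sequences have successor length, so they reduce to conses with heads [path_count _ 0], even
   for the empty graph. *)
split=> [|[eq_count0 _]]; first exact: isomorphic_path_sequence.
by apply: complete_card_isomorphic; rewrite // -!path_count0.
Qed.
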